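(* Let $r=2$, let $t\ne0,\pm1,\pm2$ be rational and let $j\ge2$ be a natural number. Then the set $\mathcal K_j(t)$ consists exactly of those primes $p\in\Pi(t)$, not dividing the numerator of $t^2-4$, for which the polynomial $\widetilde f\,c_{j-2} \bmod p$ splits linearly, where $\widetilde f(x)=x^2+t^2-4$ and $c_m(x)=C_{2^m}(x)$.
   Context: Chebyshev polynomials of the first kind: $C_0(x)=2$, $C_1(x)=x$, $C_{n+1}=xC_n-C_{n-1}$. $\Pi(t)$ is the set of primes $p\ge3$ not dividing the denominator of $t$. For $p\in\Pi(t)$, $\mathcal S_p(t)$ is the group of $2\times2$ matrices over $\mathbb F_p$ of determinant $1$ which commute with $D_t=\begin{pmatrix}0&-1\\1&t\end{pmatrix}$ mod $p$, and $\widehat p$ denotes its order. For $r=2$, $\mathcal K_j(t)=\{p\in\Pi(t): p\nmid \text{numerator of } t^2-4,\ 2^j\mid\widehat p\}$; primes dividing the numerator of $t^2-4$ are excluded from consideration. A polynomial over $\mathbb F_p$ splits linearly if it factors over $\mathbb F_p$ into linear factors. *)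

(* Defs.v *)
From HB Require Import structures.
From mathcomp Require Import all_boot all_order all_algebra all_fingroup.

Set Implicit Arguments.
Unset Strict Implicit.
Unset Printing Implicit Defensive.

Import Order.TTheory GRing.Theory Num.Theory.
Local Open Scope ring_scope.

(* Normalised so that cheb n evaluated at x + 1/x is x ^ n + 1 / x ^ n; it is
   2 T_n(x / 2) for the usual Chebyshev polynomials T_n. *)
Fixpoint cheb (n : nat) : {poly rat} :=
  match n with
  | 0 => 2%:R
  | 1 => 'X
  | (m.+1 as k).+1 => 'X * cheb k - cheb m
  end.

Definition c_poly (m : nat) : {poly rat} := cheb (2 ^ m).

Definition ftilde (t : rat) : {poly rat} := 'X^2 + (t ^+ 2 - 4%:R)%:P.

(* ratr x is numq x / denq x computed in 'F_p, which is the reduction of x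
   mod p when the prime p does not divide denq x. *)
Definition poly_mod (p : nat) (q : {poly rat}) : {poly 'F_p} :=
  map_poly ratr q.

Definition splits_linearly (F : fieldType) (q : {poly F}) : Prop :=
  exists rs : seq F, q %= \prod_(a <- rs) ('X - a%:P).

Definition Pi (t : rat) : pred nat :=
  [pred p | [&& prime p, (3 <= p)%N & ~~ (p %| `|denq t|)%N]].

Definition Dmx (t : rat) : 'M[rat]_2 :=
  \matrix_(i < 2, j < 2)
    nth 0 (nth [::] [:: [:: 0; -1];
                        [:: 1;  t]] i) j.

Definition Dmx_mod (p : nat) (t : rat) : 'M['F_p]_2 := map_mx ratr (Dmx t).

Definition Smx (p : nat) (t : rat) : {set {'GL_2['F_p]}} :=
  [set u : {'GL_2['F_p]} | (\det (GLval u) == 1) && comm_mxb (GLval u) (Dmx_mod p t)].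

Lemma Smx_group_set (p : nat) (t : rat) : group_set (Smx p t).
Proof.
apply/group_setP; split=> [|u v]; rewrite !inE.
  rewrite GL_1E det1 eqxx /=; apply/eqP; exact: comm_mx_sym (comm_mx1 _).
case/andP=> /eqP du /eqP cu /andP[/eqP dv /eqP cv].
rewrite GL_ME det_mulmx du dv mulr1 eqxx /=; apply/eqP.
apply: comm_mx_sym; exact: comm_mxM (comm_mx_sym cu) (comm_mx_sym cv).
Qed.

Canonical Smx_group (p : nat) (t : rat) : {group {'GL_2['F_p]}} :=
  Group (Smx_group_set p t).

Definition phat (p : nat) (t : rat) : nat := #|Smx p t|.

Definition Kset (j : nat) (t : rat) : pred nat :=
  [pred p | [&& p \in Pi t, ~~ (p %| `|numq (t ^+ 2 - 4%:R)|)%N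
              & (2 ^ j %| phat p t)%N]].

(* Main.v *)
Require Import Defs.
From mathcomp Require Import all_boot all_order all_algebra all_fingroup.
From mathcomp Require Import all_solvable all_field ring zify.
Set Implicit Arguments.
Unset Strict Implicit.
Unset Printing Implicit Defensive.
Import Order.TTheory GRing.Theory Num.Theory.
Local Open Scope ring_scope.

(** Write [F] for the field with [p] elements, [d] for [t ^+ 2 - 4] in [F], and
    [j = m + 2].

    The centralizer of a companion matrix consists of the matrices
    [a + c D_t], and determinant one turns it into the conic
    [u ^+ 2 - d * c ^+ 2 = 4], where [u] is the trace. Projecting the conic from
    its point [u = -2], [c = 0] identifies the remaining points with the slopes
    [s] such that [d * s ^+ 2 != 1]. Hence the group has order [p - 1] if [d] is
    a square in [F], and [p + 1] otherwise ([order_sl_cent_companion2]).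

    The factor [X ^ 2 + d] splits exactly when [- d] is a square, and, [-1] being
    a square exactly when 4 divides [p - 1], this says that the order of the
    group is, among [p - 1] and [p + 1], the one divisible by 4
    ([exists_sqr_oppr]).

    The factor [c_m] splits exactly when [2 ^ (m + 2)] divides [p - 1] or [p + 1]
    ([splits_chebval]): its roots are [x + 1/x] for [x] of order [2 ^ (m + 2)],
    and they lie in [F] when [x ^ p] is [x] or [1/x]. The proof stays inside [F]
    and rests on [C_p = X ^ p] ([chebval_pchar]). If [2 ^ (m + 2)] divides
    [p - 1] or [p + 1], then [C_p] is congruent to [C_1] modulo [c_m], so [c_m]
    divides the split polynomial [X ^ p - X]. Conversely a root [a] of [c_m]
    satisfies [C_p(a) = a ^ p = a], hence [(C_{p+1}(a) - 2) (C_{p-1}(a) - 2) = 0]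
    by [chebval_square], and [C_n(a) = 2] forces [2 ^ (m + 2)] to divide [n].

    Both conditions together say that [2 ^ j] divides [p - 1] or [p + 1] and that
    the group order is the one of the two divisible by 4; as [j >= 2], this means
    that [2 ^ j] divides the order. *)

(** * The Chebyshev recurrence in a ring *)

(** The recurrence is iterated on elements rather than on polynomials: with
    ['X] for [x] it gives the Chebyshev polynomials, and both evaluation and
    change of coefficients become instances of [rmorph_chebval]. *)
Fixpoint chebval (R : nzRingType) (x : R) (n : nat) : R :=
  match n with
  | 0 => 2%:R
  | 1 => x
  | (m.+1 as k).+1 => x * chebval x k - chebval x m
  end.

Lemma chebvalSS (R : nzRingType) (x : R) n :
  chebval x n.+2 = x * chebval x n.+1 - chebval x n.
Proof. by []. Qed.

Lemma rmorph_chebval (R S : nzRingType) (f : {rmorphism R -> S}) (x : R) n :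
  f (chebval x n) = chebval (f x) n.
Proof.
suff: f (chebval x n) = chebval (f x) n /\
      f (chebval x n.+1) = chebval (f x) n.+1 by case.
elim: n => [|n [IH1 IH2]]; first by rewrite rmorph_nat.
by split=> //; rewrite !chebvalSS rmorphB rmorphM IH1 IH2.
Qed.

Lemma chebval_addV (R : nzRingType) (x y : R) n :
  x * y = 1 -> y * x = 1 -> chebval (x + y) n = x ^+ n + y ^+ n.
Proof.
move=> xy yx.
suff: chebval (x + y) n = x ^+ n + y ^+ n /\
      chebval (x + y) n.+1 = x ^+ n.+1 + y ^+ n.+1 by case.
elim: n => [|n [IH1 IH2]]; first by rewrite !expr0 !expr1.
split=> //; rewrite chebvalSS IH1 IH2 mulrDl !mulrDr.
rewrite ![in x * y ^+ n.+1]exprS mulrA xy mul1r.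
rewrite ![in y * x ^+ n.+1]exprS [y * (x * _)]mulrA yx mul1r.
by rewrite -!exprS [x ^+ n + y ^+ n.+2]addrC addrACA [y ^+ n + _]addrC addrK.
Qed.

(** * Two by two matrices *)

Lemma ord2P (i : 'I_2) : (i == 0) || (i == 1).
Proof. by case: i => [[|[|i]] hi]. Qed.

Lemma sum_ord2 (V : nmodType) (f : 'I_2 -> V) : \sum_i f i = f 0 + f 1.
Proof.
rewrite 2!big_ord_recl big_ord0 addr0.
by congr (f _ + f _); apply: val_inj.
Qed.

Definition mx2 (R : Type) (a b c d : R) : 'M[R]_2 :=
  \matrix_(i, j) if i == 0 then if j == 0 then a else b
                  else if j == 0 then c else d.

Lemma mx2_eta (R : Type) (A : 'M[R]_2) : A = mx2 (A 0 0) (A 0 1) (A 1 0) (A 1 1).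
Proof.
apply/matrixP=> i j; rewrite mxE.
by case/orP: (ord2P i) => /eqP->; case/orP: (ord2P j) => /eqP->.
Qed.

Lemma mul_mx2 (R : pzRingType) (a b c d a' b' c' d' : R) :
  mx2 a b c d *m mx2 a' b' c' d' =
  mx2 (a * a' + b * c') (a * b' + b * d') (c * a' + d * c') (c * b' + d * d').
Proof.
apply/matrixP=> i j; rewrite !mxE sum_ord2 !mxE.
by case/orP: (ord2P i) => /eqP->; case/orP: (ord2P j) => /eqP->.
Qed.

Lemma scalar_mx2 (R : pzRingType) (a : R) : a%:M = mx2 a 0 0 a.
Proof. by rewrite [LHS]mx2_eta !mxE. Qed.

Lemma det_mx2 (R : comPzRingType) (a b c d : R) : \det (mx2 a b c d) = a * d - b * c.
Proof.
rewrite (expand_det_row _ 0) sum_ord2 /cofactor !det_mx11 !mxE /= expr0 expr1.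
by rewrite mul1r mulN1r mulrN.
Qed.

Lemma mx2_inj (R : Type) (a b c d a' b' c' d' : R) :
  mx2 a b c d = mx2 a' b' c' d' -> [/\ a = a', b = b', c = c' & d = d'].
Proof.
move=> E; split; [move: E => /matrixP/(_ 0 0)| move: E => /matrixP/(_ 0 1)
                 |move: E => /matrixP/(_ 1 0)| move: E => /matrixP/(_ 1 1)];
  by rewrite !mxE.
Qed.

(** * Identities between Chebyshev polynomials *)

(** An element [s] need not have the form [x + 1/x], but the scalar matrix [s]
    does: take for [x] the companion matrix of [X ^ 2 - s X + 1]. Identities
    between Chebyshev values thus reduce to identities between powers, over any
    commutative ring and without field extensions. *)
Lemma chebval_param (R : comNzRingType) (s : R) :
  exists x y : 'M[R]_2, [/\ x * y = 1, y * x = 1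
    & forall n, (chebval s n)%:M = x ^+ n + y ^+ n].
Proof.
exists (mx2 0 (-1) 1 s), (mx2 s 1 (-1) 0).
have xy : mx2 0 (-1) 1 s * mx2 s 1 (-1) 0 = 1.
  rewrite [_ * _]mul_mx2 -[RHS]/(1%:M) scalar_mx2; congr mx2; ring.
have yx : mx2 s 1 (-1) 0 * mx2 0 (-1) 1 s = 1.
  rewrite [_ * _]mul_mx2 -[RHS]/(1%:M) scalar_mx2; congr mx2; ring.
split=> // n; rewrite -chebval_addV // rmorph_chebval; congr chebval.
rewrite [LHS]scalar_mx2; apply/matrixP=> i j.
by rewrite !mxE; case/orP: (ord2P i) => /eqP->; case/orP: (ord2P j) => /eqP-> /=;
  rewrite ?add0r ?addr0 ?subrr ?addNr.
Qed.

Lemma scalar_mx2_inj (R : pzRingType) : injective (@scalar_mx R 2).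
Proof. by move=> a b /matrixP/(_ 0 0); rewrite !mxE. Qed.

Lemma chebval_comp (R : comNzRingType) (s : R) m n :
  chebval (chebval s m) n = chebval s (m * n).
Proof.
have [x [y [xy yx E]]] := chebval_param s; apply: scalar_mx2_inj.
have cxy : GRing.comm x y by rewrite /GRing.comm xy yx.
rewrite E rmorph_chebval /= E chebval_addV ?exprM //.
  by rewrite -exprMn_comm // xy expr1n.
by rewrite -exprMn_comm ?yx ?expr1n.
Qed.

Lemma chebval_sum (R : comNzRingType) (s : R) n k :
  chebval s (n + k + k) + chebval s n = chebval s (n + k) * chebval s k.
Proof.
have [x [y [xy yx E]]] := chebval_param s; apply: scalar_mx2_inj.
have cxy : GRing.comm x y by rewrite /GRing.comm xy yx.
have xyk i : x ^+ i * y ^+ i = 1 by rewrite -exprMn_comm // xy expr1n.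
have yxk i : y ^+ i * x ^+ i = 1 by rewrite -exprMn_comm ?yx ?expr1n.
have xyD : x ^+ (n + k) * y ^+ k = x ^+ n by rewrite exprD -mulrA xyk mulr1.
have yxD : y ^+ (n + k) * x ^+ k = y ^+ n by rewrite exprD -mulrA yxk mulr1.
rewrite rmorphD rmorphM /= !E mulrDl !mulrDr -!exprD xyD yxD.
by rewrite [y ^+ n + _]addrC addrACA.
Qed.

(** In characteristic [p] the Frobenius map is additive on the commuting
    elements [x] and [1/x], so [x ^ p + x ^ - p = (x + 1/x) ^ p]. *)
Lemma chebval_pchar (R : comNzRingType) (s : R) p :
  p \in [pchar R] -> chebval s p = s ^+ p.
Proof.
move=> pR; have [x [y [xy yx E]]] := chebval_param s; apply: scalar_mx2_inj.
have cxy : GRing.comm x y by rewrite /GRing.comm xy yx.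
have pM : p \in [pchar 'M[R]_2].
  exact: (rmorph_pchar (@scalar_mx R 2 : {rmorphism R -> 'M[R]_2})).
rewrite E -!(pFrobenius_autE pM) -pFrobenius_autD_comm //.
by rewrite pFrobenius_autE -[x in x + _]expr1 -[y in _ + y]expr1 -E /= rmorphXn.
Qed.

Lemma chebval_at2 (R : nzRingType) n : chebval (2%:R : R) n = 2%:R.
Proof.
by rewrite -[2%:R]/(1 + 1 :> R) chebval_addV ?mulr1 // expr1n.
Qed.

Lemma chebval_atN2 (R : nzRingType) n : chebval (- 2%:R : R) n = (-1) ^+ n * 2%:R.
Proof.
by rewrite mulr_natr !mulr2n opprD chebval_addV // mulrNN mulr1.
Qed.

Lemma chebval_double (R : comNzRingType) (s : R) k :
  chebval s (k + k) = chebval s k ^+ 2 - 2%:R.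
Proof. by have:= chebval_sum s 0 k; rewrite !add0n => /(canRL (addrK _)). Qed.

(** With [s = x + 1/x] both sides are [(x ^ n.+2 - 1) ^ 2 * (x ^ n - 1) ^ 2]
    divided by [x ^ (2 * n.+1)]. *)
Lemma chebval_square (R : comNzRingType) (s : R) n :
  (chebval s n.+1 - s) ^+ 2 = (chebval s n.+2 - 2%:R) * (chebval s n - 2%:R).
Proof.
have E1 := chebvalSS s n; have E2 := chebval_sum s 2 n.
have e : (2 + n + n = n.+1 + n.+1)%N by lia.
rewrite e chebval_double add2n [chebval s 2]/= in E2.
have {}E2 : chebval s n.+2 * chebval s n = chebval s n.+1 ^+ 2 + s ^+ 2 - 4%:R.
  by rewrite -E2; ring.
have {}E1 : chebval s n.+2 + chebval s n = s * chebval s n.+1.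
  by rewrite E1 subrK.
transitivity (chebval s n.+2 * chebval s n
              - 2%:R * (chebval s n.+2 + chebval s n) + 4%:R); last by ring.
by rewrite E1 E2; ring.
Qed.

(** With [a = x + 1/x], the hypothesis on [2 ^ m] says that [x] has order
    [2 ^ m.+2], and the one on [n] that [x ^ n = 1]. The proof compares values at
    [2 ^ m.+1 * o], where [o] is the odd part of [n]: if the divisibility failed,
    this would be a multiple of [n], giving the value [2], whereas an odd multiple
    of [2 ^ m.+1] gives the value [-2]. *)
Lemma chebval_root_dvdn (F : fieldType) (a : F) m n :
  2%:R != 0 :> F -> chebval a (2 ^ m) = 0 -> chebval a n = 2%:R ->
  (2 ^ m.+2 %| n)%N.
Proof.
move=> F2 am an; case: (posnP n) => [-> //|n_gt0].
have [//|] := boolP (2 ^ m.+2 %| n)%N.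
rewrite pfactor_dvdn // -ltnNge ltnS => le_e.
have [o o_odd En] := pfactor_coprime (isT : prime 2) n_gt0.
set e := logn 2 n in le_e En.
have am1 : chebval a (2 ^ m.+1) = - 2%:R.
  by rewrite expnS mul2n -addnn chebval_double am expr0n sub0r.
have := chebval_comp a (2 ^ m.+1) o.
have -> : (2 ^ m.+1 * o = n * 2 ^ (m.+1 - e))%N.
  by rewrite {1}En -mulnA -expnD subnKC // mulnC.
rewrite -chebval_comp an chebval_at2 am1 chebval_atN2 -signr_odd.
have -> : odd o by rewrite -coprime2n.
rewrite expr1 mulN1r => E; case/eqP: F2.
have : (2%:R * 2%:R : F) = 0 by rewrite mulr_natl mulr2n -{1}E addNr.
by move/eqP; rewrite mulf_eq0 orbb => /eqP.
Qed.

(** * Linear splitting of polynomials *)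

Lemma splits_dvdp (F : fieldType) (p q : {poly F}) :
  p %| q -> splits_linearly q -> splits_linearly p.
Proof.
move=> pq [rs qE]; rewrite (eqp_dvdr _ qE) in pq.
by have [m pE] := dvdp_prod_XsubC pq; exists (mask m rs).
Qed.

Lemma splits_mul (F : fieldType) (p q : {poly F}) :
  splits_linearly (p * q) <-> splits_linearly p /\ splits_linearly q.
Proof.
split=> [pq|[[rs pE] [ss qE]]].
  by split; apply: splits_dvdp pq; rewrite ?dvdp_mulIl ?dvdp_mulIr.
by exists (rs ++ ss); rewrite big_cat (eqp_trans (eqp_mulr _ pE)) ?eqp_mull.
Qed.

Lemma splits_root (F : fieldType) (p : {poly F}) :
  (1 < size p)%N -> splits_linearly p -> exists a, root p a.
Proof.
move=> p1 [[|a rs] pE]; first by rewrite (eqp_size pE) big_nil size_poly1 in p1.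
by exists a; rewrite (eqp_root pE) big_cons rootM root_XsubC eqxx.
Qed.

Lemma splits_XnCard (F : finFieldType) : splits_linearly ('X^#|F| - 'X : {poly F}).
Proof. by exists (index_enum F); rewrite finField_genPoly eqpxx. Qed.

Lemma splits_X2DC (F : fieldType) (d : F) :
  splits_linearly ('X^2 + d%:P) <-> exists a, a ^+ 2 = - d.
Proof.
split=> [/splits_root|[a aE]].
  rewrite size_polyDl size_polyXn ?(leq_ltn_trans (size_polyC_leq1 _)) //.
  case=> // a; rewrite rootE !hornerE => /eqP/(canRL (addrK _)).
  by rewrite sub0r; exists a.
exists [:: a; - a]; rewrite big_cons big_seq1.
suff -> : 'X^2 + d%:P = ('X - a%:P) * ('X - (- a)%:P) by exact: eqpxx.
by rewrite -[d]opprK -aE !polyCN polyC_exp; ring.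
Qed.

(** * Splitting of the Chebyshev polynomials of index a power of two *)

(** A root of [C_k] is [x + 1/x] with [x ^ (2 * k) = -1], so the index matters
    only modulo [4 * k]. *)
Lemma dvdp_chebval4 (F : fieldType) k n q :
  chebval ('X : {poly F}) k %| chebval 'X (n + 4 * k * q) - chebval 'X n.
Proof.
elim: q => [|q IH]; first by rewrite muln0 addn0 subrr dvdp0.
set N := (n + 4 * k * q)%N in IH.
have -> : (n + 4 * k * q.+1 = N + k + k + k + k)%N by rewrite /N; lia.
have E1 := canRL (addrK _) (chebval_sum ('X : {poly F}) N k).
have E2 := canRL (addrK _) (chebval_sum ('X : {poly F}) (N + k + k) k).
have -> : chebval 'X (N + k + k + k + k) - chebval 'X n =
  chebval 'X k * (chebval 'X (N + k + k + k) - chebval 'X (N + k)) +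
  (chebval 'X N - chebval 'X n) :> {poly F} by ring: E1 E2.
by rewrite dvdp_addr // dvdp_mulr.
Qed.

(** This is the congruence between [C_{-1} = C_1] and [C_{4 k - 1}]. *)
Lemma dvdp_chebval4N1 (F : fieldType) k : (0 < k)%N ->
  chebval ('X : {poly F}) k %| chebval 'X (4 * k).-1 - 'X.
Proof.
case: k => // k _.
have E1 := canRL (addrK _) (chebval_sum ('X : {poly F}) (k.+1 + k) k.+1).
have E2 := canRL (addrK _) (chebval_sum ('X : {poly F}) 1 k).
have -> : ((4 * k.+1).-1 = k.+1 + k + k.+1 + k.+1)%N by lia.
rewrite !add1n [chebval 'X 1]/= in E2.
have -> : chebval 'X (k.+1 + k + k.+1 + k.+1) - 'X = chebval 'X k.+1 *
  (chebval 'X (k.+1 + k + k.+1) - chebval 'X k) :> {poly F} by ring: E1 E2.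
exact: dvdp_mulr.
Qed.

Lemma size_chebvalX (F : fieldType) n : size (chebval ('X : {poly F}) n.+1) = n.+2.
Proof.
suff: (size (chebval ('X : {poly F}) n) <= n.+1)%N /\
      size (chebval ('X : {poly F}) n.+1) = n.+2 by case.
elim: n => [|n [IH1 IH2]]; first by rewrite size_polyX /= -polyC_natr size_polyC_leq1.
split; first by rewrite IH2.
have sX : size ('X * chebval ('X : {poly F}) n.+1) = n.+3.
  by rewrite mulrC size_mulX ?IH2 // -size_poly_eq0 IH2.
by rewrite chebvalSS size_polyDl sX // size_polyN ltnS (leq_trans IH1).
Qed.

Lemma Fp_natr_eq0 p n : prime p -> (n%:R == 0 :> 'F_p) = (p %| n)%N.
Proof. by move=> p_pr; rewrite (dvdn_pcharf (pchar_Fp p_pr)). Qed.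

Lemma Fp_intr_eq0 p (z : int) : prime p -> (z%:~R == 0 :> 'F_p) = (p %| `|z|)%N.
Proof.
move=> p_pr; case: (intP z) => [|n|n]; first by rewrite eqxx dvdn0.
  by rewrite -pmulrn Fp_natr_eq0.
by rewrite abszN mulrNz oppr_eq0 -pmulrn Fp_natr_eq0.
Qed.

(** The Frobenius map turns the splitting question into a comparison of [C_p]
    with [C_1]: [C_p = X ^ p], and [X ^ p - X] is the product of all the
    [X - a]. *)
Lemma splits_chebval (p m : nat) : prime p -> odd p ->
  splits_linearly (chebval ('X : {poly 'F_p}) (2 ^ m)) <->
  (2 ^ m.+2 %| p.-1)%N || (2 ^ m.+2 %| p.+1)%N.
Proof.
move=> p_pr p_odd; have p_gt1 := prime_gt1 p_pr.
have Frob (a : 'F_p) : a ^+ p = a by have := expf_card a; rewrite card_Fp.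
have cardF : #|'F_p| = p := card_Fp p_pr.
have k_gt0 : (0 < 2 ^ m)%N by rewrite expn_gt0.
have e4 : (4 * 2 ^ m = 2 ^ m.+2)%N by rewrite !expnS; lia.
split=> [|pE].
  case/splits_root=> [|a /eqP].
    by rewrite -(prednK k_gt0) size_chebvalX.
  rewrite -[_.[a]]/(horner_eval a _) rmorph_chebval /= /horner_eval hornerX => am.
  have F2 : 2%:R != 0 :> 'F_p.
    by rewrite Fp_natr_eq0 // (dvdn_prime2 p_pr) //; apply: contraL p_odd => /eqP->.
  have: (chebval a p.-1.+1 - a) ^+ 2 = 0.
    by rewrite prednK ?prime_gt0 // (chebval_pchar _ (pchar_Fp p_pr)) Frob subrr expr0n.
  rewrite chebval_square => /eqP; rewrite mulf_eq0 !subr_eq0 prednK ?prime_gt0 //.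
  by case/orP=> /eqP /(chebval_root_dvdn F2 am) ->; rewrite ?orbT.
apply: splits_dvdp (splits_XnCard 'F_p); rewrite cardF.
have pP : p \in [pchar {poly 'F_p}] by rewrite pchar_poly pchar_Fp.
rewrite -(chebval_pchar _ pP).
case/orP: pE => /dvdnP[q qE].
  rewrite [X in chebval _ X - _](_ : p = (1 + 4 * 2 ^ m * q)%N).
    exact: (dvdp_chebval4 _ _ 1).
  by rewrite e4; lia.
(* The index [p] is [q.+1] periods ahead of [-1]; the first of them is the
   business of [dvdp_chebval4N1]. *)
case: q qE => // q qE.
rewrite [X in chebval _ X - _](_ : p = ((4 * 2 ^ m).-1 + 4 * 2 ^ m * q)%N);
  last by rewrite e4; nia.
rewrite -(subrKA (chebval 'X (4 * 2 ^ m).-1)) dvdp_addr ?dvdp_chebval4 //.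
exact: dvdp_chebval4N1.
Qed.

(** * The order of the centralizer *)

(** This set is convertible to the group in the statement when [D] is the
    reduction of the matrix of [t]. *)
Definition sl_cent (F : finFieldType) (D : 'M[F]_2) : {set {'GL_2[F]}} :=
  [set u : {'GL_2[F]} | (\det (GLval u) == 1) && comm_mxb (GLval u) D].

Lemma commute_companion2 (R : comPzRingType) (t a b c d : R) :
  comm_mxb (mx2 a b c d) (mx2 0 (-1) 1 t) = (b == - c) && (d == a + t * c).
Proof.
rewrite /comm_mxb !mul_mx2; apply/eqP/andP=> [E|[/eqP-> /eqP->]].
  have [E1 _ E3 _] := mx2_inj E; split; apply/eqP; first by ring: E1.
  by ring: E3.
by congr mx2; ring.
Qed.

Lemma GL2_of_det1 (F : finFieldType) (A : 'M[F]_2) :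
  \det A = 1 -> {u : {'GL_2[F]} | GLval u = A}.
Proof.
move=> dA; have uA : A \is a GRing.unit.
  by rewrite -[_ \is a _]/(A \in unitmx) unitmxE dA unitr1.
by exists (FinRing.Unit uA).
Qed.

(** The inverse of the projection [c / (u + 2)] of the conic
    [u ^+ 2 - d * c ^+ 2 = 4], read as a matrix of trace [u] and lower left entry
    [c] commuting with the companion matrix of [X ^ 2 - t X + 1]. *)
Definition cayley (F : fieldType) (t s : F) : 'M[F]_2 :=
  let d := t ^+ 2 - 4%:R in
  let e := (1 - d * s ^+ 2)^-1 in
  mx2 ((1 + d * s ^+ 2 - 2%:R * t * s) * e) (- (4%:R * s * e))
      (4%:R * s * e) ((1 + d * s ^+ 2 + 2%:R * t * s) * e).

Lemma det_cayley (F : fieldType) (t s : F) :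
  (t ^+ 2 - 4%:R) * s ^+ 2 != 1 -> \det (cayley t s) = 1.
Proof.
move=> s1; rewrite det_mx2; field.
by rewrite subr_eq0 eq_sym.
Qed.

(** The extra point counted by the successor is [-1], the centre of the
    projection. *)
Lemma card_sl_cent_companion2 (F : finFieldType) (t : F) :
  2%:R != 0 :> F -> t ^+ 2 - 4%:R != 0 ->
  #|sl_cent (mx2 0 (-1) 1 t)| = #|[set s : F | (t ^+ 2 - 4%:R) * s ^+ 2 != 1]|.+1.
Proof.
move=> F2; set d := t ^+ 2 - 4%:R => d0; set S := sl_cent _; set T := [set s | _].
have F4 : 4%:R != 0 :> F by rewrite -[4%N]/(2 * 2)%N natrM mulf_neq0.
have SP u : u \in S -> exists a c, GLval u = mx2 a (- c) c (a + t * c)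
    /\ (a + (a + t * c)) ^+ 2 - d * c ^+ 2 = 4%:R.
  rewrite inE [GLval u]mx2_eta commute_companion2 => /and3P[/eqP du /eqP b_c /eqP d_a].
  exists (GLval u 0 0), (GLval u 1 0); split; first by rewrite -b_c -d_a.
  move: du; rewrite det_mx2 b_c d_a => du.
  by move/(congr1 ( *%R 4%:R)): du; rewrite mulr1 => <-; rewrite /d; ring.
pose c (u : {'GL_2[F]}) := GLval u 1 0.
(* The denominator of the slope: the trace plus 2. *)
pose w (u : {'GL_2[F]}) := GLval u 0 0 + GLval u 1 1 + 2%:R.
pose f u := c u / w u.
have [N GN] : {u : {'GL_2[F]} | GLval u = mx2 (-1) 0 0 (-1)}.
  by apply: GL2_of_det1; rewrite det_mx2 mulrNN mulr1 mulr0 subr0.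
have NS : N \in S.
  rewrite inE GN det_mx2 commute_companion2 mulrNN mulr1 !mulr0 subr0 oppr0 addr0.
  by rewrite !eqxx.
have w0 u : u \in S :\ N -> w u != 0.
  rewrite in_setD1 => /andP[uN uS]; apply: contraNneq uN.
  have [a [b [uE n4]]] := SP u uS; rewrite /w uE !mxE /= => w0.
  have ha : a + (a + t * b) = - 2%:R by apply/eqP; rewrite -addr_eq0 w0.
  (* On the conic, [u = -2] forces [d * b ^+ 2 = 0]. *)
  have b0 : b = 0.
    apply/eqP; move/eqP: n4; rewrite ha sqrrN -natrX subr_eq addrC -subr_eq subrr.
    by rewrite eq_sym mulf_eq0 (negPf d0) expf_eq0.
  have aN1 : a = -1.
    by apply: (mulfI F2); rewrite mulrN1 -ha b0; ring.
  by apply/eqP/val_inj; rewrite [LHS]uE [RHS]GN b0 aN1 oppr0 mulr0 addr0.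
have fP u : u \in S :\ N -> (1 - d * f u ^+ 2) * w u = 4%:R /\ GLval u = cayley t (f u).
  move=> uSN; have wu := w0 u uSN; move: uSN; rewrite in_setD1 => /andP[_ uS].
  have [a [b [uE n4]]] := SP u uS; move: wu; rewrite /f /w /c uE !mxE /=.
  set v := a + (a + t * b) + 2%:R => v0.
  have E : (1 - d * (b / v) ^+ 2) * v = 4%:R.
    have -> : (1 - d * (b / v) ^+ 2) * v = (v ^+ 2 - d * b ^+ 2) / v by field.
    have n4' : d * b ^+ 2 = (v - 2%:R) ^+ 2 - 4%:R.
      by rewrite -n4 /v addrK opprB addrCA subrr addr0.
    by apply: (canLR (mulfK v0)); rewrite n4'; ring.
  split=> //; have e0 : 1 - d * (b / v) ^+ 2 != 0.
    by apply: contraTneq F4 => e0; rewrite -E e0 mul0r eqxx.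
  have -> : cayley t (b / v) = mx2 a (- b) b (a + t * b).
    have Ei : (1 - d * (b / v) ^+ 2)^-1 = v / 4%:R.
      by apply: (mulfI e0); rewrite divff // mulrA E divff.
    have Ed : d * (b / v) ^+ 2 = 1 - 4%:R / v.
      by rewrite -E mulfK // opprB addrCA subrr addr0.
    have av : v = 2%:R * a + t * b + 2%:R by rewrite /v; ring.
    rewrite /cayley -/d Ei Ed; congr mx2.
    - transitivity ((2%:R * v - 4%:R - 2%:R * t * b) / 4%:R); first by field; rewrite F4 v0.
      by rewrite av; field.
    - by field; rewrite F4 v0.
    - by field; rewrite F4 v0.
    - transitivity ((2%:R * v - 4%:R + 2%:R * t * b) / 4%:R); first by field; rewrite F4 v0.
      by rewrite av; field.
  by [].
have GLinj : injective (@GLval 2 F) by exact: val_inj.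
have f_inj : {in S :\ N &, injective f}.
  by move=> u u' /fP[_ uE] /fP[_ u'E] fE; apply: GLinj; rewrite uE fE.
rewrite (cardsD1 N) NS -(card_in_imset f_inj) add1n; congr _.+1.
apply: eq_card => s; rewrite !inE; apply/imsetP/idP => [[u uSN ->]|s1].
  have [E _] := fP u uSN; rewrite eq_sym -subr_eq0; apply: contraTneq F4 => e0.
  by rewrite -E e0 mul0r eqxx.
have [u uE] := GL2_of_det1 (det_cayley s1).
have wE : w u = 4%:R / (1 - d * s ^+ 2).
  rewrite /w uE !mxE /= -/d; field.
  by rewrite subr_eq0 eq_sym.
have e0 : 1 - d * s ^+ 2 != 0 by rewrite subr_eq0 eq_sym.
exists u.
  rewrite !inE uE det_cayley // eqxx commute_companion2 eqxx /=; apply/andP; split.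
    apply: contraNneq (mulf_neq0 F4 (invr_neq0 e0)) => uN.
    by rewrite -wE uN /w GN !mxE /=; apply/eqP; ring.
  by apply/eqP; rewrite -/d; field.
by rewrite /f wE /c uE !mxE /= -/d; field; rewrite F4 e0.
Qed.

(** The slopes to be discarded are the square roots of [1 / d], of which there
    are two or none. *)
Lemma order_sl_cent_companion2 (F : finFieldType) (t : F) :
  2%:R != 0 :> F -> t ^+ 2 - 4%:R != 0 ->
  #|sl_cent (mx2 0 (-1) 1 t)| =
  if [exists d : F, d ^+ 2 == t ^+ 2 - 4%:R] then #|F|.-1 else #|F|.+1.
Proof.
move=> F2 d0; rewrite card_sl_cent_companion2 //.
set d := t ^+ 2 - 4%:R in d0 *; set T := [set s | _].
have cardT : (#|T| + #|~: T|)%N = #|F| by rewrite cardsC.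
have TC s : (s \in ~: T) = (d * s ^+ 2 == 1) by rewrite !inE negbK.
case: existsP => [[e /eqP eE]|no_sqrt].
  have e0 : e != 0 by apply: contraNneq d0 => e0; rewrite -eE e0 expr0n.
  have TCE : ~: T = [set e^-1; - e^-1].
    apply/setP=> s; rewrite TC -eE -exprMn sqrf_eq1 !inE.
    by rewrite -invrN !(can2_eq (mulKf e0) (mulVKf e0)) mulr1 mulrN1 -invrN.
  have e2 : e^-1 != - e^-1.
    by rewrite -addr_eq0 -mulr2n -mulr_natl mulf_neq0 // invr_eq0.
  by rewrite -cardT TCE cards2 e2 addn2.
have TC0 : ~: T = set0.
  apply/setP=> s; rewrite TC inE; apply/negP=> /eqP s1; apply: no_sqrt.
  exists (s^-1); have s0 : s != 0.
    by apply: contra_eq_neq s1 => ->; rewrite expr0n mulr0 eq_sym oner_eq0.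
  by rewrite exprVn; apply/eqP/(mulIf (expf_neq0 2 s0)); rewrite s1 mulVf ?expf_neq0.
by rewrite -cardT TC0 cards0 addn0.
Qed.

Lemma Dmx_modE p t : Dmx_mod p t = mx2 0 (-1) 1 (ratr t).
Proof.
rewrite [LHS]mx2_eta !mxE /= (ratr_int _ 0) (ratr_int _ (-1)) (ratr_int _ 1).
by rewrite mulrN1z.
Qed.

(** * Squares in a finite field *)

(** For a primitive root [z] of unity of order [h.*2], an element [z ^+ i] is a
    square if and only if [i] is even, and [-1] is [z ^+ h]. *)
Lemma exists_sqr_oppr (F : finFieldType) (x : F) h : #|F| = h.*2.+1 -> x != 0 ->
  [exists y : F, y ^+ 2 == - x] = ([exists y : F, y ^+ 2 == x] == ~~ odd h).
Proof.
move=> cardF x0.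
have units_pow (y : F) : y != 0 -> y ^+ h.*2 = 1.
  by move=> y0; apply: (mulfI y0); rewrite mulr1 -exprS -cardF expf_card.
have h_gt0 : (0 < h.*2)%N.
  by rewrite -ltnS -cardF (cardD1 0) (cardD1 1) !inE oner_eq0.
have [z z_prim]: exists z : F, h.*2.-primitive_root z.
  suff /hasP[z _]: has h.*2.-primitive_root (enum [pred y : F | y != 0]) by exists z.
  apply: has_prim_root; rewrite ?enum_uniq //.
    by apply/allP=> y; rewrite mem_enum inE unity_rootE => /units_pow->.
  rewrite -cardE; have := cardC1 (0 : F); rewrite cardF /= => <-.
  by rewrite subset_leq_card //; apply/subsetP=> y.
have zh : z ^+ h = -1.
  have /eqP : (z ^+ h) ^+ 2 = 1 by rewrite -exprM muln2 (prim_expr_order z_prim).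
  rewrite sqrf_eq1 => /orP[|/eqP//].
  by rewrite -(prim_order_dvd z_prim) gtnNdvd //; lia.
have sqr_pow i : [exists y : F, y ^+ 2 == z ^+ i] = ~~ odd i.
  apply/existsP/idP=> [[y /eqP yE]|i_even].
    have [|k yk] := prim_rootP z_prim (units_pow y _).
      apply: contraPneq yE => ->; rewrite expr0n => /eqP.
      by rewrite eq_sym expf_eq0 (prim_root_eq0 z_prim) => /andP[_ /eqP hz]; lia.
    move/eqP: yE; rewrite yk -exprM (eq_prim_root_expr z_prim) => /eqP E.
    by have := congr1 odd E; rewrite !odd_mod ?odd_double // muln2 odd_double => <-.
  by exists (z ^+ i./2); rewrite -exprM muln2 even_halfK.
have [i ->] := prim_rootP z_prim (units_pow x x0).
by rewrite -[- _]mulN1r -zh -exprD !sqr_pow oddD; do 2!case: (odd _).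
Qed.

(** * Reduction modulo a prime *)

(** Into a field of positive characteristic [ratr] is not a ring morphism; it
    can nevertheless be computed on any fraction with invertible denominator, in
    lowest terms or not. *)
Lemma ratr_frac (F : fieldType) (n d : int) : d%:~R != 0 :> F ->
  (denq (n%:~R / d%:~R))%:~R != 0 :> F /\
  ratr (n%:~R / d%:~R) = n%:~R / d%:~R :> F.
Proof.
case: divqP => [|k x k0]; first by rewrite eqxx.
rewrite !rmorphM /= mulf_eq0 negb_or => /andP[Fk Fd]; split=> //.
by rewrite -mulf_div divff // mul1r.
Qed.

Lemma poly_mod_frac p (P : {poly int}) (d : int) : d%:~R != 0 :> 'F_p ->
  poly_mod p (d%:~R^-1 *: map_poly intr P) = d%:~R^-1 *: map_poly intr P.
Proof.
move=> d0; apply/polyP=> i.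
rewrite coefZ coef_map_id0; last by rewrite (ratr_nat _ 0).
by rewrite coefZ !coef_map /= ![_^-1 * _]mulrC (ratr_frac _ d0).2.
Qed.

Lemma cheb_chebval n : cheb n = chebval 'X n.
Proof.
suff: cheb n = chebval 'X n /\ cheb n.+1 = chebval 'X n.+1 by case.
by elim: n => [|n [IH1 IH2]] //; split=> //; rewrite chebvalSS -IH1 -IH2.
Qed.

Lemma map_chebvalX (R S : nzRingType) (f : {rmorphism R -> S}) n :
  map_poly f (chebval 'X n) = chebval 'X n.
Proof. by rewrite rmorph_chebval /= map_polyX. Qed.

(** Since [poly_mod] is not multiplicative, the product is first written as an
    integer polynomial divided by the square of the denominator of [t]. *)
Lemma poly_mod_ftilde_c p t m : (denq t)%:~R != 0 :> 'F_p ->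
  poly_mod p (ftilde t * c_poly m) =
  ('X^2 + (ratr t ^+ 2 - 4%:R)%:P) * chebval 'X (2 ^ m).
Proof.
move=> b0; pose n := numq t; pose b := denq t.
have b2 : (b ^+ 2)%:~R != 0 :> 'F_p by rewrite rmorphXn expf_neq0.
(* Used for both [rat] and the field with [p] elements. *)
have clearden (K : fieldType) : b%:~R != 0 :> K ->
    ((b ^+ 2)%:~R)^-1 *: map_poly intr
      ((b ^+ 2 *: 'X^2 + (n ^+ 2 - 4%:R * b ^+ 2)%:P) * chebval 'X (2 ^ m)) =
    ('X^2 + ((n%:~R / b%:~R) ^+ 2 - 4%:R)%:P) * chebval 'X (2 ^ m) :> {poly K}.
  move=> Kb; rewrite [map_poly _ _]rmorphM /= map_chebvalX scalerAl; congr (_ * _).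
  rewrite rmorphD /= map_polyZ /= map_polyXn map_polyC /= scalerDr scalerA.
  have Kb2 : (b ^+ 2)%:~R != 0 :> K by rewrite rmorphXn expf_neq0.
  rewrite mulVf // scale1r scale_polyC; congr (_ + _%:P).
  by rewrite rmorphB rmorphM !rmorphXn /=; field.
have bQ : b%:~R != 0 :> rat by rewrite intr_eq0 denq_neq0.
have -> : ftilde t * c_poly m =
    ('X^2 + ((n%:~R / b%:~R) ^+ 2 - 4%:R)%:P) * chebval 'X (2 ^ m).
  by rewrite /ftilde /c_poly cheb_chebval divq_num_den.
by rewrite -clearden // poly_mod_frac // clearden.
Qed.

Lemma ratr_X2B4_neq0 p t : prime p -> (denq t)%:~R != 0 :> 'F_p ->
  ~~ (p %| `|numq (t ^+ 2 - 4%:R)|)%N -> ratr t ^+ 2 - 4%:R != 0 :> 'F_p.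
Proof.
move=> p_pr b0; rewrite -Fp_intr_eq0 //.
have b2 : (denq t ^+ 2)%:~R != 0 :> 'F_p by rewrite rmorphXn expf_neq0.
have bQ : (denq t)%:~R != 0 :> rat by rewrite intr_eq0 denq_neq0.
have tE : t ^+ 2 - 4%:R = (numq t ^+ 2 - 4%:R * denq t ^+ 2)%:~R / (denq t ^+ 2)%:~R.
  by rewrite -{1}(divq_num_den t) rmorphB rmorphM !rmorphXn /=; field.
have [d0 rE] := ratr_frac (numq t ^+ 2 - 4%:R * denq t ^+ 2) b2.
rewrite -tE in d0 rE; move=> n0.
have <- : ratr (t ^+ 2 - 4%:R) = ratr t ^+ 2 - 4%:R :> 'F_p.
  by rewrite rE rmorphB rmorphM !rmorphXn /= /ratr; field.
by rewrite /ratr mulf_neq0 // invr_eq0.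
Qed.

Theorem theorem17 (t : rat) (j : nat)
    (ht : [/\ t != 0, t != 1, t != -1, t != 2%:R & t != - 2%:R])
    (hj : (2 <= j)%N) :
  forall p : nat,
    p \in Kset j t <->
    [/\ p \in Pi t,
        ~~ (p %| `|numq (t ^+ 2 - 4%:R)|)%N
      & splits_linearly (poly_mod p (ftilde t * c_poly (j - 2)))].
Proof.
move=> p; rewrite inE.
suff equiv : p \in Pi t -> ~~ (p %| `|numq (t ^+ 2 - 4%:R)|)%N ->
    (2 ^ j %| phat p t)%N <->
    splits_linearly (poly_mod p (ftilde t * c_poly (j - 2))).
  by split=> [/and3P[pP pn K]|[pP pn K]]; have [E1 E2] := equiv pP pn;
    [split=> //; exact: E1 | rewrite pP pn; exact: E2].
rewrite inE => /and3P[p_pr p_gt2 pb] pn.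
rewrite -Fp_intr_eq0 // in pb.
have p_odd : odd p by case/even_prime: p_pr p_gt2 => // ->.
have F2 : 2%:R != 0 :> 'F_p by rewrite Fp_natr_eq0 // gtnNdvd.
have d0 := ratr_X2B4_neq0 p_pr pb pn.
have cardF : #|'F_p| = p := card_Fp p_pr.
have pE : p = (p./2).*2.+1 by rewrite -[LHS]odd_double_half p_odd.
have sqrN := exists_sqr_oppr (etrans cardF pE) d0.
have ordS : phat p t = if [exists d : 'F_p, d ^+ 2 == ratr t ^+ 2 - 4%:R]
                       then p.-1 else p.+1.
  rewrite -[LHS]/#|sl_cent (Dmx_mod p t)| Dmx_modE.
  by rewrite order_sl_cent_companion2 // cardF.
rewrite poly_mod_ftilde_c //; set m := (j - 2)%N.
have -> : j = m.+2 by rewrite /m; lia.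
have d4 x : (2 ^ m.+2 %| x)%N -> (4 %| x)%N.
  by apply: dvdn_trans; rewrite (dvdn_exp2l 2 (isT : 2 <= m.+2)%N).
set d := ratr t ^+ 2 - 4%:R in d0 sqrN ordS *.
apply: (iff_trans (B := [exists y : 'F_p, y ^+ 2 == - d] &&
    ((2 ^ m.+2 %| p.-1)%N || (2 ^ m.+2 %| p.+1)%N))); last first.
  apply: iff_sym; apply: (iff_trans (splits_mul _ _)).
  have [A1 A2] := splits_X2DC d.
  have [B1 B2] := splits_chebval m p_pr p_odd.
  split=> [[/A1[a aE] /B1->]|/andP[/existsP[a /eqP aE] /B2 B]].
    by rewrite andbT; apply/existsP; exists a; apply/eqP.
  by split=> //; apply: A2; exists a.
(* Only one of [p.-1] and [p.+1] is a multiple of 4, and [sqrN] says that it is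
   the order of the group. *)
rewrite sqrN ordS; case: [exists _, _]; split.
- move=> p1; rewrite p1; have := d4 _ p1; lia.
- case/andP=> h_even /orP[//|/d4]; lia.
- move=> p1; rewrite p1 orbT; have := d4 _ p1; lia.
- case/andP=> h_odd /orP[/d4|//]; lia.
Qed.
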